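(* Let $\mathcal{W}\subset\mathcal{B}(\mathcal{F}_{wm}(\ell^2(\mathbb{Z})))$ be the $C^*$-algebra generated by the weakly monotone annihilators $\{A_i:i\in\mathbb{Z}\}$. The orthogonal projection $P_\Omega$ onto the line spanned by the vacuum vector $\Omega$ does not belong to $\mathcal{W}$.
   Context: Let $\mathcal{H}=\ell^2(\mathbb{Z})$ with canonical orthonormal basis $\{e_k:k\in\mathbb{Z}\}$. The weakly monotone Fock space $\mathcal{F}_{wm}(\mathcal{H})$ is the closed subspace of the full Fock space over $\mathcal{H}$ with orthonormal basis consisting of the vacuum vector $\Omega$ (the tensor of length $0$) and all simple tensors $e_{i_1}\otimes\cdots\otimes e_{i_k}$ with $k\geq 1$, $i_1\geq i_2\geq\cdots\geq i_k$, $i_j\in\mathbb{Z}$. For $i\in\mathbb{Z}$ the creator $A_i^\dagger$ is the bounded operator with $A_i^\dagger\Omega=e_i$ and $A_i^\dagger\, e_{i_1}\otimes\cdots\otimes e_{i_k}=e_i\otimes e_{i_1}\otimes\cdots\otimes e_{i_k}$ if $i\geq i_1$, and $=0$ otherwise; the annihilator $A_i$ is its adjoint. The $C^*$-algebra generated by a set of operators is not assumed to contain the identity. *)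

(* Defs.v *)
From HB Require Import structures.
From mathcomp Require Import all_boot all_order all_algebra.
From mathcomp Require Import finmap complex sesquilinear.
From mathcomp Require Import all_classical all_reals all_analysis.
From mathcomp Require Import ring lra.
From mathcomp.analysis.showcase Require summability.
Set Implicit Arguments.
Unset Strict Implicit.
Unset Printing Implicit Defensive.
Import Order.TTheory GRing.Theory Num.Theory numFieldNormedType.Exports.
Import ComplexField.Normc.
Local Open Scope ring_scope.
Local Open Scope classical_set_scope.
Local Open Scope complex_scope.

(* Unconditional sum of a family of complex numbers: the limit of the sums over
   finite index sets, directed by inclusion. *)
Definition usum (R : realType) (I : choiceType) (a : I -> R[i]) : R[i] :=
  summability.sum (a : I -> R[i]^o).

Definition square_summable (R : realType) (I : choiceType) (f : I -> R[i]) :=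
  summable [set: I] (fun w => (normc (f w) ^+ 2)%:E).

#[local] Existing Instance summability.totally_filter.

Section usum.
Context {R : realType} {I : choiceType}.
Implicit Types (a b : I -> R[i]) (r s : I -> R) (A B : {fset I}).
Notation C := R[i].
Notation tot := (@summability.totally I).

(* Elementary form of the convergence that defines [usum]; see [sums_toP]. *)
Definition sums_to a (l : C) :=
  forall e : R, 0 < e -> exists B, forall A, (B `<=` A)%fset ->
    normc (\sum_(w <- A) a w - l) < e.

Lemma normcE (z : C) : `|z| = (normc z)%:C.
Proof. by rewrite normc_def; case: z. Qed.

Lemma partial_sumE a A :
  summability.partial_sum (a : I -> C^o) A = \sum_(w <- A) a w.
Proof. by rewrite /summability.partial_sum big_seq_fsetE. Qed.

Lemma sums_toP a l :
  sums_to a l <-> summability.partial_sum (a : I -> C^o) @ tot --> (l : C^o).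
Proof.
split=> [al|/cvgrPdist_lt al e e0].
  apply/cvgrPdist_lt => /= e; rewrite ltcE /= => /andP[/eqP ime re0].
  have [B Bal] := al _ re0.
  exists B => // A /= BA; rewrite partial_sumE distrC normcE ltcE /= ime eqxx /=.
  exact: Bal.
have /al[B _ Bal] : 0 < e%:C by rewrite ltcR.
exists B => A /Bal /=; rewrite partial_sumE distrC normcE ltcR; exact.
Qed.

Lemma usumE a l : sums_to a l -> usum a = l.
Proof. by move=> /sums_toP al; apply: (cvg_lim (@norm_hausdorff _ _) al). Qed.

Lemma normc_ge0 (z : C) : 0 <= normc z.
Proof. by rewrite -lecR -normcE normr_ge0. Qed.

Lemma normc_conj (z : C) : normc z^*%R = normc z.
Proof. by apply: (@complexI R); rewrite -!normcE norm_conjC. Qed.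

Lemma normcR (x : R) : normc x%:C = `|x|.
Proof. by rewrite /= expr0n /= addr0 sqrtr_sqr. Qed.

Lemma Re_le_normc (z : C) : `|complex.Re z| <= normc z.
Proof. by case: z => x y /=; rewrite -sqrtr_sqr ler_wsqrtr// lerDl sqr_ge0. Qed.

Lemma Im_le_normc (z : C) : `|complex.Im z| <= normc z.
Proof. by case: z => x y /=; rewrite -sqrtr_sqr ler_wsqrtr// lerDr sqr_ge0. Qed.

Lemma eq_sums_to a b l : a =1 b -> sums_to a l -> sums_to b l.
Proof. by move=> /funext ->. Qed.

Lemma sums_toD a b l m : sums_to a l -> sums_to b m -> sums_to (a \+ b) (l + m).
Proof.
move=> al bm e e0; have e2 : 0 < e / 2 by rewrite divr_gt0.
have [B1 h1] := al _ e2; have [B2 h2] := bm _ e2.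
exists (B1 `|` B2)%fset => A; rewrite fsubUset => /andP[/h1 k1 /h2 k2].
rewrite big_split /= opprD addrACA [e]splitr.
by rewrite (le_lt_trans (le_normcD _ _))// ltrD.
Qed.

Lemma sums_toZ c a l : sums_to a l -> sums_to (fun w => c * a w) (c * l).
Proof.
move=> al e e0; have [->|c0] := eqVneq c 0.
  exists fset0 => A _; rewrite big1 => [|w _]; last by rewrite mul0r.
  by rewrite mul0r subrr normc0.
have nc : 0 < normc c.
  by rewrite lt_def normc_ge0 andbT; apply: contra c0 => /eqP/eq0_normc ->.
have [|B h] := al (e / normc c); first by rewrite divr_gt0.
exists B => A /h; rewrite -mulr_sumr -mulrBr normcM ltr_pdivlMr//.
by rewrite mulrC.
Qed.

Lemma sums_to_conj a l : sums_to a l -> sums_to (fun w => (a w)^*%R) l^*%R.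
Proof.
move=> al e /al[B h]; exists B => A /h.
by rewrite -rmorph_sum -rmorphB /= normc_conj.
Qed.

Lemma ler_sum_fsub r A B : (forall w, 0 <= r w) -> (A `<=` B)%fset ->
  \sum_(w <- A) r w <= \sum_(w <- B) r w.
Proof.
move=> r0 AB; rewrite (eq_big_seq (fun w => if w \in A then r w else 0)); last first.
  by move=> w ->.
rewrite (big_fset_incl _ AB) => [|w _ /negbTE -> //].
by apply: ler_sum => w _; case: ifP.
Qed.

Lemma sums_to_nneg r (M : R) : (forall w, 0 <= r w) ->
  (forall A, \sum_(w <- A) r w <= M) -> exists l, sums_to (fun w => (r w)%:C) l.
Proof.
move=> r0 rM; pose S := [set x | exists A, x = \sum_(w <- A) r w].
have S0 : S !=set0 by exists 0, fset0; rewrite big_seq_fset0.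
have hS : has_sup S by split=> //; exists M => _ [A ->].
exists (sup S)%:C => e e0; have [_ [B ->] Be] := sup_adherent e0 hS.
exists B => A BA; rewrite -rmorph_sum -rmorphB normcR /= distrC ger0_norm.
  rewrite ltrBlDr addrC -ltrBlDr (lt_le_trans Be)//.
  exact: ler_sum_fsub.
by rewrite subr_ge0; apply: ub_le_sup; [case: hS|exists A].
Qed.

Lemma sums_to_dominated a (M : R) :
  (forall A, \sum_(w <- A) normc (a w) <= M) -> exists l, sums_to a l.
Proof.
move=> aM.
have real_part r : (forall w, `|r w| <= normc (a w)) ->
    exists l, sums_to (fun w => (r w)%:C) l.
  move=> ra.
  have [|A|l1 h1] := @sums_to_nneg (fun w => normc (a w) + r w) (M + M).
  - by move=> w; rewrite -lerBlDr sub0r (le_trans _ (ra w))// -normrN ler_norm.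
  - rewrite big_split /= lerD// (le_trans _ (aM A))// ler_sum// => w _.
    by rewrite (le_trans (ler_norm _)).
  have [|A|l2 h2] := @sums_to_nneg (fun w => normc (a w)) M.
  - by move=> w; exact: normc_ge0.
  - exact: aM.
  exists (l1 + (-1) * l2).
  apply: eq_sums_to (sums_toD h1 (sums_toZ (-1) h2)) => w /=.
  by rewrite mulN1r rmorphD /= addrAC subrr add0r.
have [x hx] := real_part (fun w => complex.Re (a w)) (fun w => Re_le_normc _).
have [y hy] := real_part (fun w => complex.Im (a w)) (fun w => Im_le_normc _).
exists (x + 'i%C * y); apply: eq_sums_to (sums_toD hx (sums_toZ _ hy)) => w /=.
by rewrite -complexE.
Qed.

Lemma sums_to_ge r (x : R) l : (forall w, 0 <= r w) ->
  sums_to (fun w => (r w)%:C) l -> (exists A, x <= \sum_(w <- A) r w) ->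
  x%:C <= l.
Proof.
move=> r0 rl [A0 xA0].
have rlr (e : R) : 0 < e -> exists A, [/\ normc (\sum_(w <- A) (r w)%:C - l) < e &
    x <= \sum_(w <- A) r w].
  move=> /rl[B h]; exists (B `|` A0)%fset; split; first by apply: h; exact: fsubsetUl.
  rewrite (le_trans xA0)//.
  exact/ler_sum_fsub/fsubsetUr.
rewrite lecE; apply/andP; split; rewrite /=.
  apply/eqP; apply/eqP; rewrite -normr_le0; apply/ler_addgt0Pr => e /rlr[A [Al _]].
  rewrite add0r ltW// (le_lt_trans _ Al)// (le_trans _ (Im_le_normc _))//.
  by rewrite -rmorph_sum; case: (l) => u v /=; rewrite sub0r normrN.
apply/ler_addgt0Pr => e /rlr[A [Al xA]].
rewrite (le_trans xA)// -lerBlDl (le_trans (ler_norm _))// ltW//.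
rewrite (le_lt_trans _ Al)// (le_trans _ (Re_le_normc _))//.
by rewrite -rmorph_sum; case: (l) => u v.
Qed.

Lemma sums_to_le r (M : R) l : (forall A, \sum_(w <- A) r w <= M) ->
  sums_to (fun w => (r w)%:C) l -> complex.Re l <= M.
Proof.
move=> rM rl; apply/ler_addgt0Pr => e /rl[B /(_ B (fsubset_refl _)) Bl].
rewrite -lerBlDr (le_trans _ (rM B))// lerBlDr -lerBlDl.
rewrite (le_trans (ler_norm _))// ltW// (le_lt_trans _ Bl)//.
rewrite (le_trans _ (Re_le_normc _))//.
by rewrite -rmorph_sum; case: (l) => u v /=; rewrite distrC.
Qed.

Lemma square_summableP (f : I -> C) : square_summable f <->
  exists M : R, forall A, \sum_(w <- A) normc (f w) ^+ 2 <= M.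
Proof.
rewrite /square_summable /summable.
have -> : (\esum_(w in [set: I]) `|(normc (f w) ^+ 2)%:E| =
           \esum_(w in [set: I]) (normc (f w) ^+ 2)%:E)%E.
  by apply: eq_esum => w _; rewrite gee0_abs// lee_fin sqr_ge0.
split=> [foo|[M fM]].
  have : \esum_(w in [set: I]) (normc (f w) ^+ 2)%:E \is a fin_num.
    by rewrite ge0_fin_numE// esum_ge0// => w _; rewrite lee_fin sqr_ge0.
  move=> fin; exists (fine (\esum_(w in [set: I]) (normc (f w) ^+ 2)%:E)) => A.
  rewrite -lee_fin fineK// esum_ge//; exists [set` A].
    by split=> //; exact: finite_fset.
  by rewrite fsbig_finite//= set_fsetK sumEFin.
apply: (@le_lt_trans _ _ M%:E); last exact: ltry.
apply: ub_ereal_sup => _ [X [finX _] <-].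
by rewrite fsbig_finite//= sumEFin lee_fin.
Qed.

End usum.
Section ell2_type.
Context (R : realType) (I : choiceType).
Notation C := R[i].

Definition ell2_pred : {pred I -> C} := [pred f | `[< square_summable f >]].

Lemma ell2_predP (f : I -> C) : f \in ell2_pred <->
  exists M : R, forall A : {fset I}, \sum_(w <- A) normc (f w) ^+ 2 <= M.
Proof.
rewrite -square_summableP; split=> [/asboolW //|fS]; exact: asboolT.
Qed.

Lemma ell2_submod_closed : submod_closed ell2_pred.
Proof.
split.
  apply/ell2_predP; exists 0 => A; rewrite big1// => w _.
  by rewrite -[normc _]/(normc (0 : C)) normc0 expr0n.
move=> c f g /ell2_predP[M fM] /ell2_predP[N gN]; apply/ell2_predP.
exists ((normc c ^+ 2 * M + N) *+ 2) => A.
apply: (@le_trans _ _ ((normc c ^+ 2 * \sum_(w <- A) normc (f w) ^+ 2 +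
                        \sum_(w <- A) normc (g w) ^+ 2) *+ 2)); last first.
  by rewrite lerMn2r /= lerD// ler_wpM2l// sqr_ge0.
rewrite mulr_sumr -big_split /= -sumrMnl ler_sum// => w _.
rewrite -exprMn -normcM.
have le1 : normc ((c *: f + g) w) <= normc (c * f w) + normc (g w).
  exact: le_normcD.
apply: (@le_trans _ _ ((normc (c * f w) + normc (g w)) ^+ 2)).
  by rewrite ler_pXn2r ?nnegrE ?addr_ge0 ?normc_ge0.
rewrite sqrrD mulr2n -subr_ge0.
have := sqr_ge0 (normc (c * f w) - normc (g w)).
rewrite sqrrB; congr (_ <= _); ring.
Qed.

HB.instance Definition _ :=
  GRing.isSubmodClosed.Build C (I -> C) ell2_pred ell2_submod_closed.

Record ell2 := Ell2 { ell2_fun :> I -> C; _ : ell2_fun \in ell2_pred }.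
HB.instance Definition _ := [isSub for ell2_fun].
HB.instance Definition _ := [Choice of ell2 by <:].
HB.instance Definition _ := [SubChoice_isSubLmodule of ell2 by <:].

End ell2_type.

Section ell2_theory.
Context {R : realType} {I : choiceType}.
Notation C := R[i].
Notation H := (ell2 R I).
Implicit Types (f g h : H) (A B : {fset I}).

Lemma ell2P f g : (f =1 g) -> f = g.
Proof. by move=> fg; apply/val_inj/funext. Qed.

Lemma ell2_bound f : exists M : R, forall A, \sum_(w <- A) normc (f w) ^+ 2 <= M.
Proof. exact/ell2_predP/(valP f). Qed.

Lemma ell2DE f g w : (f + g) w = f w + g w. Proof. by []. Qed.
Lemma ell2ZE (c : C) f w : (c *: f) w = c * f w. Proof. by []. Qed.
Lemma ell20E w : (0 : H) w = 0. Proof. by []. Qed.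

(* Linear in the first argument, conjugate-linear in the second; the family is
   always summable, see [ip_sums_to]. *)
Definition ip f g : C := usum (fun w => f w * (g w)^*%R).

Lemma ip_sums_to f g : sums_to (fun w => f w * (g w)^*%R) (ip f g).
Proof.
suff [l fgl] : exists l, sums_to (fun w => f w * (g w)^*%R) l.
  by rewrite /ip (usumE fgl).
have [M fM] := ell2_bound f; have [N gN] := ell2_bound g.
apply: (@sums_to_dominated _ _ _ (M + N)) => A.
rewrite (le_trans _ (lerD (fM A) (gN A)))// -big_split ler_sum//= => w _.
rewrite normcM normc_conj.
have := normc_ge0 (f w); have := normc_ge0 (g w).
move: (normc (f w)) (normc (g w)) => x y; nra.
Qed.

Lemma ip_linearl g : linear_for *%R (ip^~ g).
Proof.
move=> c f f'; apply: usumE.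
apply: eq_sums_to (sums_toD (sums_toZ c (ip_sums_to f g)) (ip_sums_to f' g)).
by move=> w; rewrite [RHS]mulrDl; congr (_ + _); exact: mulrA.
Qed.

Lemma ip_conj f g : ip f g = (ip g f)^*%R.
Proof.
apply: usumE; apply: eq_sums_to (sums_to_conj (ip_sums_to g f)) => w.
by rewrite [LHS]rmorphM [RHS]mulrC; congr (_ * _); exact: conjCK.
Qed.

Lemma ip_linearr f : linear_for (Num.conj \; *%R) (ip f).
Proof.
move=> c g g'; rewrite ip_conj ip_linearl rmorphD rmorphM /=.
by rewrite -!ip_conj.
Qed.

HB.instance Definition _ := bilinear_isBilinear.Build C H H C
  ( *%R ) (Num.conj \; *%R) ip (ip_linearl, ip_linearr).

Lemma ip_herm f g : ip f g = (-1) ^+ false * Num.conj (ip g f).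
Proof. by rewrite expr0 mul1r -ip_conj. Qed.

HB.instance Definition _ :=
  isHermitianSesquilinear.Build C H false Num.conj ip ip_herm.

Lemma ip_diag_sums_to f : sums_to (fun w => (normc (f w) ^+ 2)%:C) (ip f f).
Proof.
apply: eq_sums_to (ip_sums_to f f) => w.
by rewrite -normCK normcE -rmorphXn.
Qed.

Lemma ip_gt0 f : f != 0 -> 0 < ip f f.
Proof.
move=> f0; have [w fw] : exists w, f w != 0.
  apply: contrapT => fN; move/eqP: f0; apply; apply: ell2P => w.
  by apply: contrapT => fw; apply: fN; exists w; exact/eqP.
have nfw : 0 < normc (f w) ^+ 2.
  rewrite exprn_gt0// lt_def normc_ge0 andbT.
  by apply: contra fw => /eqP/eq0_normc ->.
apply: (@lt_le_trans _ _ (normc (f w) ^+ 2)%:C); first by rewrite ltcR.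
apply: (sums_to_ge _ (ip_diag_sums_to f)) => [v|]; first exact: sqr_ge0.
by exists [fset w]%fset; rewrite big_seq_fset1.
Qed.

HB.instance Definition _ := isDotProduct.Build C H ip ip_gt0.

Let dot : {dot H for Num.conj} := ip.

Lemma ip_ge0 f : 0 <= ip f f. Proof. exact: (dnorm_ge0 dot). Qed.

Lemma ip_CauchySchwarz f g : `|ip f g| <= sqrtC (ip f f) * sqrtC (ip g g).
Proof.
have [->|g0] := eqVneq g 0.
  by rewrite -[ip f 0]/(dot f 0) linear0r normr0 mulr_ge0// sqrtC_ge0 ip_ge0.
have g1 : 0 < ip g g by exact: ip_gt0.
pose a := ip f g; pose h := ip g g *: f - a *: g.
have : 0 <= ip h h by exact: ip_ge0.
have -> : ip h h = ip g g * (ip f f * ip g g - `|a| ^+ 2).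
  have gg : (ip g g)^*%R = ip g g by rewrite -ip_conj.
  rewrite -[ip h h]/(dot h h) /h linearBl linearBr linearBr /=.
  rewrite !linearZl_LR !linearZr_LR /= -![dot _ _]/(ip _ _).
  by rewrite (ip_conj g f) normCK gg -/a; ring.
rewrite pmulr_rge0// subr_ge0 => le2.
rewrite -(sqrCK (normr_ge0 _)) -sqrtCM ?nnegrE ?ip_ge0//.
by rewrite ler_sqrtC ?nnegrE ?mulr_ge0 ?ip_ge0 ?exprn_ge0.
Qed.

Definition ell2_norm f : C := sqrtC (ip f f).

Lemma ell2_normD f g : ell2_norm (f + g) <= ell2_norm f + ell2_norm g.
Proof.
have n0 h : 0 <= ell2_norm h by rewrite sqrtC_ge0 ip_ge0.
rewrite -(@ler_pXn2r _ 2)// ?nnegrE ?addr_ge0//.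
rewrite sqrrD !sqrtCK -[ip (f + g) _]/(dot (f + g) (f + g)) dnormD /=.
rewrite [leRHS]addrAC lerD2l -![dot _ _]/(ip _ _) -mulr_natr.
have -> : ip f g + (ip f g)^*%R = 'Re (ip f g) * 2%:R.
  by rewrite ReE mulfVK// pnatr_eq0.
rewrite ler_pM2r ?ltr0n// (le_trans _ (ip_CauchySchwarz f g))//.
by rewrite leif_Re_Creal.
Qed.

Lemma ell2_normZ (c : C) f : ell2_norm (c *: f) = `|c| * ell2_norm f.
Proof.
rewrite /ell2_norm -[ip (c *: f) _]/(dot (c *: f) (c *: f)) dnormZ.
by rewrite sqrtCM ?nnegrE ?ip_ge0 ?exprn_ge0// sqrCK.
Qed.

Lemma ell2_norm0_eq0 f : ell2_norm f = 0 -> f = 0.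
Proof. by move/eqP; rewrite sqrtC_eq0 -[ip f f]/(dot f f) dnorm_eq0 => /eqP. Qed.

HB.instance Definition _ :=
  Lmodule_isNormed.Build C H ell2_normD ell2_normZ ell2_norm0_eq0.

Lemma ell2_normE f : `|f| = sqrtC (ip f f). Proof. by []. Qed.

End ell2_theory.

Section ell2_basis.
Context {R : realType} {I : choiceType}.
Notation C := R[i].
Notation H := (ell2 R I).
Implicit Types (f g : H) (v w : I).

Lemma ell2_basis_subproof w : (fun v => (v == w)%:R : C) \in @ell2_pred R I.
Proof.
apply/ell2_predP; exists 1 => A.
apply: (@le_trans _ _ (\sum_(v <- (w |` A)%fset) normc ((v == w)%:R : C) ^+ 2)).
  apply: ler_sum_fsub => [v|]; [exact: sqr_ge0|exact: fsubsetU1].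
rewrite (big_fsetD1 w) ?fset1U1//= eqxx normc1 expr1n big1_fset ?addr0// => v.
by rewrite in_fsetD1 => /andP[/negbTE -> _] _; rewrite normc0 expr0n.
Qed.

Definition basis w : H := Ell2 (ell2_basis_subproof w).

Lemma ip_basis f w : ip f (basis w) = f w.
Proof.
apply: usumE => e e0; exists [fset w]%fset => A /fsubsetP/(_ w (fset11 w)) wA.
rewrite (big_fsetD1 w wA) /= eqxx rmorph1 mulr1 big1_fset ?addr0 ?subrr ?normc0//.
by move=> v; rewrite in_fsetD1 => /andP[/negbTE -> _] _; rewrite rmorph0 mulr0.
Qed.

Lemma basis_orthonormal v w : ip (basis v) (basis w) = (v == w)%:R.
Proof. by rewrite ip_basis eq_sym. Qed.

Lemma basis_total f : (forall w, ip f (basis w) = 0) -> f = 0.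
Proof. by move=> f0; apply: ell2P => w; rewrite -ip_basis f0. Qed.

End ell2_basis.

Section operators.
Context {R : realType} {I : choiceType}.
Notation C := R[i].
Notation H := (ell2 R I).
Implicit Types (S T : H -> H) (A G : set (H -> H)).

Definition bounded_operator T :=
  linear T /\ exists M : R, forall f, `|T f| <= M%:C * `|f|.

(* S is the adjoint of T. *)
Definition is_adjoint T S := forall f g, ip (T f) g = ip f (S g).

(* C*-subalgebras of B(H), not necessarily containing the identity. The last
   field is closure in operator norm: ||T - S|| <= e is spelled out as a bound
   on every vector. *)
Record cstar_subalgebra A : Prop := {
  cstar_bounded : A `<=` bounded_operator ;
  cstar0 : A (fun=> 0) ;
  cstarD : forall S T, A S -> A T -> A (fun f => S f + T f) ;
  cstarZ : forall (c : C) T, A T -> A (fun f => c *: T f) ;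
  cstarM : forall S T, A S -> A T -> A (S \o T) ;
  cstar_adjoint : forall S T,
    A S -> bounded_operator T -> is_adjoint S T -> A T ;
  cstar_closed : forall T, bounded_operator T ->
    (forall e : R, 0 < e -> exists2 S, A S &
       forall f, `|T f - S f| <= e%:C * `|f|) -> A T }.

(* [smallest] is an intersection; it is over a nonempty family as soon as G
   consists of bounded operators, see [cstar_generated_cstar]. *)
Definition cstar_generated G := smallest cstar_subalgebra G.

Definition orthogonal_projection (L : set H) (P : H -> H) :=
  forall f, L (P f) /\ forall g, L g -> ip (f - P f) g = 0.

Lemma adjoint_unique T S S' : is_adjoint T S -> is_adjoint T S' -> S = S'.
Proof.
move=> TS TS'; apply/funext => g; apply: ell2P => w.
by rewrite -!ip_basis ip_conj -TS TS' -ip_conj.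
Qed.

Lemma bounded_operatorD S T :
  bounded_operator S -> bounded_operator T ->
  bounded_operator (fun f => S f + T f).
Proof.
move=> [lS [M SM]] [lT [N TN]]; split.
  by move=> c f g /=; rewrite lS lT scalerDr addrACA.
exists (M + N) => f; rewrite (le_trans (ler_normD _ _))//.
by rewrite rmorphD mulrDl lerD.
Qed.

Lemma bounded_operatorZ (c : C) T :
  bounded_operator T -> bounded_operator (fun f => c *: T f).
Proof.
move=> [lT [N TN]]; split.
  by move=> d f g /=; rewrite lT scalerDr !scalerA mulrC.
exists (normc c * N) => f.
by rewrite normrZ rmorphM -mulrA normcE ler_wpM2l// -normcE.
Qed.

Lemma bounded_operator_comp S T :
  bounded_operator S -> bounded_operator T -> bounded_operator (S \o T).
Proof.
move=> [lS [M SM]] [lT [N TN]]; split.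
  by move=> c f g /=; rewrite lT lS.
exists (`|M| * N) => f; rewrite (le_trans (SM _))//.
rewrite rmorphM -mulrA (@le_trans _ _ (`|M|%:C * `|T f|))//.
  by rewrite ler_wpM2r// lecR ler_norm.
by rewrite ler_wpM2l// lecR.
Qed.

Lemma bounded_operator_cstar : cstar_subalgebra bounded_operator.
Proof.
split=> //.
- split; first by move=> c f g; rewrite scaler0 addr0.
  by exists 0 => f; rewrite normr0 mul0r.
- exact: bounded_operatorD.
- exact: bounded_operatorZ.
- exact: bounded_operator_comp.
Qed.

Lemma cstar_generated_cstar G :
  G `<=` bounded_operator -> cstar_subalgebra (cstar_generated G).
Proof.
move=> Gb; split.
- by apply: smallest_sub => //; exact: bounded_operator_cstar.
- by move=> A [AC _]; exact: cstar0.
- by move=> S T hS hT A hA; apply: (cstarD hA.1); [exact: hS|exact: hT].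
- by move=> c T hT A hA; apply: (cstarZ hA.1); exact: hT.
- by move=> S T hS hT A hA; apply: (cstarM hA.1); [exact: hS|exact: hT].
- by move=> S T hS bT ST A hA; apply: (cstar_adjoint hA.1 _ bT ST); exact: hS.
- move=> T bT h A hA; apply: (cstar_closed hA.1 bT) => e /h[S hS TS].
  by exists S => //; exact: hS.
Qed.

End operators.

Section partial_injection.
Context {R : realType} {I : choiceType}.
Notation C := R[i].
Notation H := (ell2 R I).
Context (p q : I -> option I).
Context (pq : forall w v, p w = Some v <-> q v = Some w).
Implicit Types (f g : H) (A B : {fset I}).

Definition pull_img A : {fset I} := [fset v in pmap p A]%fset.

Lemma big_pull_img (V : zmodType) (F : I -> I -> V) A :
  \sum_(w <- A) (if p w is Some v then F w v else 0) =
  \sum_(v <- pull_img A) (if q v is Some w then F w v else 0).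
Proof.
have p_inj w w' v : p w = Some v -> p w' = Some v -> w = w'.
  by move=> /pq qv /pq; rewrite qv => -[].
have umap (s : seq I) : uniq s -> uniq (pmap p s).
  elim: s => //= w s IH /andP[ws us]; case pw: (p w) => [v|] /=; last exact: IH.
  rewrite IH// andbT mem_pmap; apply: contra ws => /mapP[w' w's pw'].
  by rewrite (p_inj w w' v).
rewrite [RHS](perm_big (pmap p A)) /=; last first.
  apply: uniq_perm; [exact: fset_uniq|exact/umap/fset_uniq|].
  by move=> v; rewrite -[LHS]/(v \in pull_img A) /pull_img !inE.
elim: (enum_fset A) => [|w s IH] /=; first by rewrite !big_nil.
rewrite big_cons IH; case pw: (p w) => [v|] /=; last by rewrite add0r.
by rewrite big_cons; have /pq -> := pw.
Qed.

(* For p and q mutually inverse partial injections, [pull] is the partial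
   isometry sending the basis vector at v to the one at w if q v = Some w, and
   to 0 if q v = None. *)
Definition pull_fun f w : C := if p w is Some v then f v else 0.

Lemma pull_bound f (M : R) : (forall A, \sum_(w <- A) normc (f w) ^+ 2 <= M) ->
  forall A, \sum_(w <- A) normc (pull_fun f w) ^+ 2 <= M.
Proof.
move=> fM A; rewrite (le_trans _ (fM (pull_img A)))//.
rewrite (eq_bigr (fun w => if p w is Some v then normc (f v) ^+ 2 else 0)).
  rewrite (big_pull_img (fun _ v => normc (f v) ^+ 2)) ler_sum// => v _.
  by case: (q v) => // *; exact: sqr_ge0.
by move=> w _; rewrite /pull_fun; case: (p w) => //; rewrite normc0 expr0n.
Qed.

Lemma pull_subproof f : pull_fun f \in @ell2_pred R I.
Proof.
by apply/ell2_predP; have [M fM] := ell2_bound f; exists M; exact: pull_bound.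
Qed.

Definition pull f : H := Ell2 (pull_subproof f).

Lemma pullE f w : pull f w = if p w is Some v then f v else 0.
Proof. by []. Qed.

Lemma pull_bounded_operator : bounded_operator pull.
Proof.
split.
  move=> c f g; apply: ell2P => w.
  rewrite pullE -[RHS]/(c * pull_fun f w + pull_fun g w) /pull_fun.
  by case: (p w) => [v|] //; rewrite mulr0 addr0.
exists 1 => f; rewrite rmorph1 mul1r !ell2_normE.
rewrite ler_sqrtC ?nnegrE ?ip_ge0//.
have im0 : complex.Im (ip f f) = 0 by exact/ger0_Im/ip_ge0.
have im1 : complex.Im (ip (pull f) (pull f)) = 0 by exact/ger0_Im/ip_ge0.
rewrite lecE im0 im1 eqxx /=.
apply: (sums_to_le _ (ip_diag_sums_to (pull f))); apply: pull_bound => A.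
rewrite -lecR (@le_trans _ _ (ip f f))//.
  apply: (sums_to_ge _ (ip_diag_sums_to f)) => [v|]; first exact: sqr_ge0.
  by exists A.
by rewrite lecE im0 eqxx /=.
Qed.

End partial_injection.

Lemma pull_adjoint (R : realType) (I : choiceType) (p q : I -> option I)
    (pq : forall w v, p w = Some v <-> q v = Some w)
    (qp : forall w v, q w = Some v <-> p v = Some w) :
  is_adjoint (@pull R I p q pq) (pull qp).
Proof.
move=> f g; apply: usumE => e /(ip_sums_to f (pull qp g))[B hB].
exists (pull_img q B) => A /fsubsetP BA.
rewrite (eq_bigr (fun w => if p w is Some v then f v * (g w)^*%R else 0)); last first.
  by move=> w _; rewrite pullE; case: (p w) => [v|] //; rewrite mul0r.
rewrite (big_pull_img pq (fun w v => f v * (g w)^*%R)).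
rewrite (eq_bigr (fun v => f v * (pull qp g v)^*%R)); last first.
  move=> v _; rewrite (pullE qp); case: (q v) => [w|] //.
  by rewrite rmorph0 mulr0.
rewrite (big_fset_incl _ (fsubsetUl _ B)); first by apply: hB; exact: fsubsetUr.
move=> v; rewrite in_fsetU => /orP[->//|vB] vA; rewrite pullE.
case qv: (q v) => [w|]; last by rewrite rmorph0 mulr0.
have /BA wA : w \in pull_img q B.
  by rewrite !inE mem_pmap -qv; apply: map_f.
move: vA; rewrite !inE mem_pmap => /negP[]; apply/mapP; exists w => //.
by apply/esym/pq.
Qed.

Definition wm_word := {w : seq int | sorted >=%R w}.

(* Prepend i, if the result is weakly decreasing. *)
Definition wm_add (i : int) (w : wm_word) : option wm_word := insub (i :: val w).

(* Remove the leading letter, if it is i. *)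
Definition wm_del (i : int) (w : wm_word) : option wm_word :=
  if val w is j :: s then if j == i then insub s else None else None.

Lemma wm_delK i w v : wm_del i w = Some v <-> wm_add i v = Some w.
Proof.
rewrite /wm_del /wm_add; split.
  case def_w: (val w) => [|j s] //; case: eqP => // ji.
  case: insubP => // u _ us [uv]; rewrite -uv us -ji.
  by case: insubP => [u' _ u'E|/negP[]]; [congr Some; apply: val_inj; rewrite u'E|rewrite -def_w (valP w)].
by case: insubP => // u _ us [<-]; rewrite us eqxx valK.
Qed.

Lemma wm_addK i w v : wm_add i w = Some v <-> wm_del i v = Some w.
Proof. by split=> /wm_delK. Qed.

(* The weakly monotone Fock space over l^2(Z). The full Fock space over l^2(Z)
   has the simple tensors e_{i_1} (x) ... (x) e_{i_k}, k >= 0, as orthonormal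
   basis, so it is l^2 of the set of words of integers; the closed subspace
   spanned by the weakly decreasing ones is l^2 of the set of these words. *)
Definition wm_fock (R : realType) := ell2 R wm_word.

Section wm_fock.
Context {R : realType}.

(* e_{i_1} (x) ... (x) e_{i_k} if the word is weakly decreasing, 0 otherwise. *)
Definition tensor (s : seq int) : wm_fock R := if insub s is Some w then basis w else 0.

Definition vacuum : wm_fock R := tensor [::].

(* (A_i^+ f)(i :: v) = f(v), and (A_i^+ f)(w) = 0 if w does not start with i;
   see [creator_vacuum] and [creator_tensor] for the action on the basis. *)
Definition creator (i : int) : wm_fock R -> wm_fock R := pull (wm_delK i).

Definition is_annihilator (i : int) (T : wm_fock R -> wm_fock R) :=
  bounded_operator T /\ is_adjoint (creator i) T.

Lemma creator_bounded i : bounded_operator (creator i).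
Proof. exact: pull_bounded_operator. Qed.

Lemma creator_basis i w :
  creator i (basis w) = if wm_add i w is Some v then basis v else 0.
Proof.
apply: ell2P => u; rewrite pullE.
case wv: (wm_add i w) => [v|]; case uu: (wm_del i u) => [u'|] //=.
- congr ((_ : bool)%:R); apply/eqP/eqP => [u'w|uv].
    by move/wm_delK: uu; rewrite u'w wv => -[].
  by move/wm_addK: wv; rewrite -uv uu => -[].
- case: eqP => // uv; move/wm_addK: wv; rewrite -uv uu //.
- by case: eqP => // u'w; move/wm_delK: uu; rewrite u'w wv.
Qed.

Lemma creator_vacuum i : creator i vacuum = tensor [:: i].
Proof. by rewrite /vacuum /tensor insubT creator_basis /wm_add. Qed.

Lemma creator_tensor i j s : sorted >=%R (j :: s) ->
  creator i (tensor (j :: s)) = if j <= i then tensor [:: i, j & s] else 0.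
Proof.
move=> js; rewrite {1}/tensor insubT creator_basis /wm_add /=.
case: ifP => ji; first by rewrite /tensor.
by rewrite insubF //= ji.
Qed.

Lemma annihilator_exists i : is_annihilator i (pull (wm_addK i)).
Proof.
by split; [exact: pull_bounded_operator|exact: pull_adjoint].
Qed.

Definition vacuum_line : set (wm_fock R) := [set c *: vacuum | c in [set: R[i]]].

Lemma vacuum_projection_exists :
  orthogonal_projection vacuum_line (fun f => ip f vacuum *: vacuum).
Proof.
move=> f; split; first by exists (ip f vacuum).
move=> _ [c _ <-].
have vv : ip vacuum vacuum = 1 :> R[i].
  by rewrite /vacuum /tensor insubT basis_orthonormal eqxx.
pose dot : {dot (wm_fock R) for Num.conj} := ip.
rewrite -[ip _ _]/(dot _ _) linearZr_LR linearBl linearZl_LR /=.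
by rewrite -![dot _ _]/(ip _ _) vv mulr1 subrr mulr0.
Qed.

Definition wm_algebra : set (wm_fock R -> wm_fock R) :=
  cstar_generated [set T | exists i, is_annihilator i T].

Lemma wm_algebra_cstar : cstar_subalgebra wm_algebra.
Proof. by apply: cstar_generated_cstar => T [i []]. Qed.

End wm_fock.

Arguments vacuum_line R : clear implicits.
Arguments wm_algebra R : clear implicits.

(* Main.v *)
Require Import Defs.
From mathcomp Require Import all_boot all_order all_algebra.
From mathcomp Require Import complex.
From mathcomp Require Import all_classical all_reals all_analysis.
From mathcomp Require Import lra.
Import Defs.
Set Implicit Arguments.
Unset Strict Implicit.
Unset Printing Implicit Defensive.
Import Order.TTheory GRing.Theory Num.Theory numFieldNormedType.Exports.
Import ComplexField.Normc.
Local Open Scope ring_scope.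
Local Open Scope classical_set_scope.
Local Open Scope complex_scope.

(** The idea is that the algebra cannot tell the vacuum from a one-letter tensor
    e_k with k very negative. Let V_k be the partial isometry that appends the
    letter k at the right end of a word all of whose letters are >= k, and
    kills the other words. Creators act on the left end of a word, and for
    k < i they do not notice a letter k at the right end: they commute with
    V_k and with its adjoint [chop_op k]; see [commutator_creator_append_op]
    and [commutator_creator_chop_op].

    For any sequence of partial isometries V_n with adjoints W_n, the bounded
    operators T such that [T, V_n] and [T, W_n] tend to 0 in operator norm form
    a C*-algebra ([asymptotic_commutant_cstar]). With k = -n this C*-algebra
    contains every creator, hence every annihilator, hence the algebra they
    generate. It does not contain the vacuum projection P: since
    V_k Omega = e_k, we get V_k P Omega - P V_k Omega = e_k, which has norm 1
    for every k. *)

(** * Bounded operators and their adjoints *)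

Section operator_lemmas.
Context {R : realType} {I : choiceType}.
Notation H := (ell2 R I).
Implicit Types (f g : H) (S T V W : H -> H).

Lemma linear_opB T f g : linear T -> T (f - g) = T f - T g.
Proof.
by move=> lT; rewrite [f - g]addrC -scaleN1r lT scaleN1r addrC.
Qed.

Lemma linear_op0 T : linear T -> T 0 = 0.
Proof. by move=> lT; have := linear_opB 0 0 lT; rewrite !subrr. Qed.

Lemma linear_opZ T (c : R[i]) f : linear T -> T (c *: f) = c *: T f.
Proof. by move=> lT; rewrite -[c *: f]addr0 lT linear_op0// addr0. Qed.

Lemma bounded_operator_gt0 T : bounded_operator T ->
  exists2 M : R, 0 < M & forall f, `|T f| <= M%:C * `|f|.
Proof.
move=> [_ [M TM]]; exists (`|M| + 1) => [|f]; first by rewrite ltr_wpDl.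
apply: (le_trans (TM f)); rewrite ler_wpM2r// lecR.
by rewrite (le_trans (ler_norm M))// lerDl.
Qed.

Lemma ipBl f f' g : ip (f - f') g = ip f g - ip f' g.
Proof. by rewrite -scaleN1r addrC ip_linearl mulN1r addrC. Qed.

Lemma ipBr f g g' : ip f (g - g') = ip f g - ip f g'.
Proof. by rewrite ip_conj ipBl rmorphB /= -!ip_conj. Qed.

Lemma sqr_ell2_norm f : `|f| ^+ 2 = ip f f.
Proof. by rewrite ell2_normE sqrtCK. Qed.

Lemma is_adjoint_sym T S : is_adjoint T S -> is_adjoint S T.
Proof. by move=> TS f g; rewrite ip_conj -TS -ip_conj. Qed.

(** Bound <S f, S f> = <T (S f), f> by Cauchy-Schwarz and divide by the norm
    of S f. *)
Lemma adjoint_norm_le T S (M : R[i]) : 0 <= M -> is_adjoint T S ->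
  (forall f, `|T f| <= M * `|f|) -> forall f, `|S f| <= M * `|f|.
Proof.
move=> M0 TS TM f; have [->|Sf0] := eqVneq (S f) 0.
  by rewrite normr0 mulr_ge0.
rewrite -(@ler_pM2r _ `|S f|) ?normr_gt0// -expr2 sqr_ell2_norm.
rewrite -TS -[leLHS]ger0_norm ?TS ?ip_ge0// -TS.
apply: (le_trans (ip_CauchySchwarz _ _)); rewrite -!ell2_normE.
by rewrite mulrAC ler_wpM2r.
Qed.

(** W V is an orthogonal projection, so |f|^2 - |V f|^2 is the squared norm of
    f - W (V f). *)
Lemma partial_isometry_contraction V W : is_adjoint V W ->
  (forall f, V (W (V f)) = V f) -> forall f, `|V f| <= `|f|.
Proof.
move=> VW VWV f; rewrite -(@ler_pXn2r _ 2)// ?nnegrE//.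
rewrite !sqr_ell2_norm -subr_ge0.
suff -> : ip f f - ip (V f) (V f) = ip (f - W (V f)) (f - W (V f)).
  exact: ip_ge0.
rewrite ipBr !ipBl -(VW (W (V f))) VWV -(VW f) (is_adjoint_sym VW).
by rewrite subrr subr0.
Qed.

End operator_lemmas.

(** * Operators that asymptotically commute with a sequence *)

Section asymptotic_commutant.
Context {R : realType} {I : choiceType}.
Notation H := (ell2 R I).
Implicit Types (S T : H -> H) (V W : nat -> H -> H).

Definition commutator S T : H -> H := fun f => S (T f) - T (S f).

(** The commutators tend to 0 in operator norm, not just pointwise: this makes
    the condition pass to adjoints. *)
Definition asymptotically_commutes V T := forall e : R, 0 < e ->
  \forall n \near \oo, forall f, `|commutator T (V n) f| <= e%:C * `|f|.

(** Taking an adjoint exchanges the conditions for V and W when W n is the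
    adjoint of V n, hence both are required. *)
Definition asymptotic_commutant V W : set (H -> H) := [set T |
  [/\ bounded_operator T, asymptotically_commutes V T
    & asymptotically_commutes W T]].

Section closure.
Context {V : nat -> H -> H}.
Hypotheses (lV : forall n, linear (V n)) (V1 : forall n f, `|V n f| <= `|f|).

Lemma asymptotically_commutes0 : asymptotically_commutes V (fun=> 0).
Proof.
move=> e e0; near=> n => f.
by rewrite /commutator linear_op0// subrr normr0 mulr_ge0// lecR ltW.
Unshelve. all: by end_near. Qed.

Lemma asymptotically_commutesD S T :
  asymptotically_commutes V S -> asymptotically_commutes V T ->
  asymptotically_commutes V (fun f => S f + T f).
Proof.
move=> VS VT e e0; have e2 : 0 < e / 2 by rewrite divr_gt0.
near=> n => f.
have -> : commutator (fun f => S f + T f) (V n) f =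
          commutator S (V n) f + commutator T (V n) f.
  rewrite /commutator -[S f]scale1r lV !scale1r opprD addrACA; congr (_ + _).
rewrite (le_trans (ler_normD _ _))// [e]splitr rmorphD mulrDl lerD//.
- by move: f; near: n; exact: VS.
- by move: f; near: n; exact: VT.
Unshelve. all: by end_near. Qed.

Lemma asymptotically_commutesZ (c : R[i]) T :
  asymptotically_commutes V T -> asymptotically_commutes V (fun f => c *: T f).
Proof.
move=> VT e e0.
have c0 : 0 < normc c + 1 by rewrite ltr_wpDl// normc_ge0.
near=> n => f.
have -> : commutator (fun f => c *: T f) (V n) f = c *: commutator T (V n) f.
  by rewrite /commutator linear_opZ// scalerBr.
rewrite normrZ normcE.
apply: (@le_trans _ _ ((normc c + 1)%:C * ((e / (normc c + 1))%:C * `|f|))).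
  apply: ler_pM => //; first by rewrite lecR normc_ge0.
    by rewrite lecR lerDl.
  by move: f; near: n; apply: VT; rewrite divr_gt0.
by rewrite mulrA -rmorphM /= [(_ + _) * _]mulrC divfK// gt_eqF.
Unshelve. all: by end_near. Qed.

(** Leibniz rule: [S T, V] = S [T, V] + [S, V] T. *)
Lemma asymptotically_commutes_comp S T :
  bounded_operator S -> bounded_operator T ->
  asymptotically_commutes V S -> asymptotically_commutes V T ->
  asymptotically_commutes V (S \o T).
Proof.
move=> bS bT VS VT e e0.
have [M M0 SM] := bounded_operator_gt0 bS.
have [N N0 TN] := bounded_operator_gt0 bT.
have e2 : 0 < e / 2 by rewrite divr_gt0.
near=> n => f.
have -> : commutator (S \o T) (V n) f =
          S (commutator T (V n) f) + commutator S (V n) (T f).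
  by rewrite /commutator (linear_opB _ _ bS.1) /= addrA subrK.
rewrite (le_trans (ler_normD _ _))// [e]splitr rmorphD mulrDl lerD//.
- apply: (le_trans (SM _)).
  apply: (@le_trans _ _ (M%:C * ((e / 2 / M)%:C * `|f|))); last first.
    by rewrite mulrA -rmorphM /= [M * _]mulrC divfK ?gt_eqF.
  rewrite ler_wpM2l ?lecR ?(ltW M0)//.
  by move: f; near: n; apply: VT; rewrite divr_gt0.
- apply: (@le_trans _ _ ((e / 2 / N)%:C * `|T f|)).
    by move: (T f); near: n; apply: VS; rewrite divr_gt0.
  apply: (@le_trans _ _ ((e / 2 / N)%:C * (N%:C * `|f|))).
    by rewrite ler_wpM2l// lecR ltW// divr_gt0.
  by rewrite mulrA -rmorphM /= divfK ?gt_eqF.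
Unshelve. all: by end_near. Qed.

(** [T, W_n] is the adjoint of - [S, V_n], so its norm is at most that of
    [S, V_n]. *)
Lemma asymptotically_commutes_adjoint W S T :
  (forall n, is_adjoint (V n) (W n)) -> is_adjoint S T ->
  asymptotically_commutes V S -> asymptotically_commutes W T.
Proof.
move=> VW ST VS e e0; near=> n.
apply: (@adjoint_norm_le _ _ (fun f => V n (S f) - S (V n f))).
- by rewrite lecR ltW.
- by move=> f g; rewrite /commutator ipBl ipBr (VW n) ST ST (VW n).
- by move=> f; rewrite distrC; move: f; near: n; exact: VS.
Unshelve. all: by end_near. Qed.

(** [T, V_n] = (T - S) V_n + [S, V_n] - V_n (T - S); the outer terms are small
    uniformly in n because the V_n are contractions. *)
Lemma asymptotically_commutes_closed T :
  (forall e : R, 0 < e -> exists2 S, asymptotically_commutes V S &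
     forall f, `|T f - S f| <= e%:C * `|f|) ->
  asymptotically_commutes V T.
Proof.
move=> TS e e0; have e3 : 0 < e / 3 by rewrite divr_gt0.
have [S VS {}TS] := TS _ e3; near=> n => f.
have -> : commutator T (V n) f =
    (T (V n f) - S (V n f)) + commutator S (V n) f - V n (T f - S f).
  rewrite /commutator (linear_opB _ _ (lV n)) opprB.
  by rewrite subrKA subrKA.
apply: (@le_trans _ _ ((e / 3)%:C * `|f| + (e / 3)%:C * `|f| +
                       (e / 3)%:C * `|f|)).
  rewrite (le_trans (ler_normB _ _))// lerD//; last first.
    exact: le_trans (V1 _ _) (TS f).
  rewrite (le_trans (ler_normD _ _))// lerD//.
    by rewrite (le_trans (TS _))// ler_wpM2l// lecR ltW.
  by move: f; near: n; exact: VS.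
rewrite -!mulrDl -!rmorphD /= ler_wpM2r// lecR.
lra.
Unshelve. all: by end_near. Qed.
End closure.

Lemma asymptotic_commutant_cstar V W :
  (forall n, linear (V n)) -> (forall n, linear (W n)) ->
  (forall n, is_adjoint (V n) (W n)) ->
  (forall n f, V n (W n (V n f)) = V n f) ->
  (forall n f, W n (V n (W n f)) = W n f) ->
  cstar_subalgebra (asymptotic_commutant V W).
Proof.
move=> lV lW VW VWV WVW.
have WV n : is_adjoint (W n) (V n) by exact/is_adjoint_sym.
have V1 n : forall f, `|V n f| <= `|f|.
  exact: partial_isometry_contraction (VW n) (VWV n).
have W1 n : forall f, `|W n f| <= `|f|.
  exact: partial_isometry_contraction (WV n) (WVW n).
have B := @bounded_operator_cstar R I.
split.
- by move=> T [].
- split; [exact: cstar0 B|exact: asymptotically_commutes0..].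
- move=> S T [bS VS WS] [bT VT WT].
  by split; [exact: cstarD B _ _ _ _|exact: asymptotically_commutesD..].
- move=> c T [bT VT WT].
  by split; [exact: cstarZ B _ _ _|exact: asymptotically_commutesZ..].
- move=> S T [bS VS WS] [bT VT WT].
  by split; [exact: cstarM B _ _ _ _|exact: asymptotically_commutes_comp..].
- move=> S T [bS VS WS] bT ST.
  split=> //.
  + exact: asymptotically_commutes_adjoint WV ST WS.
  + exact: asymptotically_commutes_adjoint VW ST VS.
- move=> T bT TS; split=> //.
  + apply: asymptotically_commutes_closed => // e /TS[S [_ VS _] hS].
    by exists S.
  + apply: asymptotically_commutes_closed => // e /TS[S [_ _ WS] hS].
    by exists S.
Qed.

End asymptotic_commutant.

(** * Appending and removing a letter at the right end of a word *)

Definition wm_append (k : int) (w : wm_word) : option wm_word :=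
  insub (rcons (val w) k).

Definition wm_chop (k : int) (w : wm_word) : option wm_word :=
  if val w is j :: s then
    if last j s == k then insub (belast j s) else None
  else None.

Lemma wm_appendK k w v : wm_append k w = Some v <-> wm_chop k v = Some w.
Proof.
rewrite /wm_append /wm_chop; split.
  case: insubP => // u _ uE [<-]; rewrite uE.
  case def_w: (val w) => [|j s] /=;
    by rewrite ?last_rcons ?belast_rcons eqxx -?def_w valK.
case def_v: (val v) => [|j s] //; case: eqP => // jk.
case: insubP => // u _ us [uw]; rewrite -uw us -jk -lastI.
case: insubP => [u' _ u'E|/negP[]]; last by rewrite -def_v (valP v).
by congr Some; apply: val_inj; rewrite u'E.
Qed.

Lemma wm_chopK k w v : wm_chop k w = Some v <-> wm_append k v = Some w.
Proof. by split=> /wm_appendK. Qed.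

(** The two ends of a word interfere only if the word has a single letter, and
    then it cannot be both i and k. *)
Lemma wm_del_chop (i k : int) w : k < i ->
  obind (wm_chop k) (wm_del i w) = obind (wm_del i) (wm_chop k w).
Proof.
move=> ki; case: w => [[|j [|j' s]] ws] //=.
  rewrite /wm_del /wm_chop /=; case: eqP => [->|_].
    by rewrite insubT /= gt_eqF.
  by case: eqP => // _; rewrite insubT.
rewrite /wm_del /wm_chop /=.
have s's : sorted >=%R (j' :: s) by case/andP: ws.
have bs : sorted >=%R (j :: belast j' s).
  have : subseq (j :: belast j' s) [:: j, j' & s].
    by rewrite (lastI j') -rcons_cons subseq_rcons.
  move=> /subseq_sorted; apply => // x y z xy yz; exact: le_trans yz xy.
have b's : sorted >=%R (belast j' s) by move/path_sorted: bs.
case: eqP => ji; last first.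
  by case: eqP => // _; rewrite insubT /=; case: eqP.
rewrite insubT /=; case: eqP => // _.
by rewrite insubT insubT /= ji eqxx insubT.
Qed.

(** Here k < i serves twice: on the empty word, the appended letter k is not
    the letter i to be removed; and if a word starts with i, appending k to it
    and to its tail are possible simultaneously, even when the tail is empty. *)
Lemma wm_del_append (i k : int) w : k < i ->
  obind (wm_append k) (wm_del i w) = obind (wm_del i) (wm_append k w).
Proof.
move=> ki; case: w => [[|j s] js]; rewrite /wm_del /wm_append /=.
  by rewrite insubT /= lt_eqF.
have s_sorted : sorted >=%R s := path_sorted js.
have rcons_sorted : j = i ->
    sorted >=%R (j :: rcons s k) = sorted >=%R (rcons s k).
  move=> ji; case: s js {s_sorted} => [|j' s] /=; first by rewrite ji (ltW ki).
  by move=> /andP[-> _].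
case: eqP => [ji|/eqP ji]; last first.
  by case: insubP => //= u _ ->; rewrite (negbTE ji).
rewrite insubT /=; case: insubP => [u|] us.
  move=> uE; rewrite insubT ?rcons_sorted//= => {}us.
  by rewrite ji eqxx -uE valK.
by rewrite insubF // rcons_sorted //; exact: negbTE.
Qed.

Section pull.
Context {R : realType} {I : choiceType}.
Implicit Types (f : ell2 R I).

Lemma comp_pull (p q p' q' : I -> option I)
    (pq : forall w v, p w = Some v <-> q v = Some w)
    (pq' : forall w v, p' w = Some v <-> q' v = Some w) f w :
  pull pq (pull pq' f) w = if obind p' (p w) is Some v then f v else 0.
Proof. by rewrite pullE; case: (p w). Qed.

Lemma pullK (p q : I -> option I)
    (pq : forall w v, p w = Some v <-> q v = Some w)
    (qp : forall w v, q w = Some v <-> p v = Some w) f :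
  pull pq (pull qp (pull pq f)) = pull pq f.
Proof.
apply: ell2P => w; rewrite !pullE; case pw: (p w) => [v|//].
by rewrite pullE; have /pq -> := pw; rewrite pullE pw.
Qed.

Lemma pull_basis (p q : I -> option I)
    (pq : forall w v, p w = Some v <-> q v = Some w) v :
  pull pq (basis v) = (if q v is Some w then basis w else 0) :> ell2 R I.
Proof.
apply: ell2P => u; rewrite pullE.
case pu: (p u) => [v'|]; case qv: (q v) => [w|] //=.
- congr ((_ : bool)%:R); apply/eqP/eqP => [v'v|uw].
    by move: pu; rewrite v'v => /pq; rewrite qv => -[].
  by move/pq: qv; rewrite -uw pu => -[].
- by case: eqP => // v'v; move: pu; rewrite v'v => /pq; rewrite qv.
- by case: eqP => // uw; move/pq: qv; rewrite -uw pu.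
Qed.

End pull.

(** * The vacuum projection *)

Section vacuum_projection.
Context {R : realType}.
Notation H := (wm_fock R).

(** In the partial isometry [pull], the first of the two mutually inverse maps
    goes from the output word to the input word; hence appending a letter to
    the basis vectors is the [pull] along [wm_chop]. *)
Definition append_op (k : int) : H -> H := pull (wm_chopK k).

Definition chop_op (k : int) : H -> H := pull (wm_appendK k).

Lemma commutator_creator_append_op (i k : int) f : k < i ->
  commutator (creator i) (append_op k) f = 0.
Proof.
move=> ki; apply/eqP; rewrite subr_eq0; apply/eqP/ell2P => w.
by rewrite !comp_pull wm_del_chop.
Qed.

Lemma commutator_creator_chop_op (i k : int) f : k < i ->
  commutator (creator i) (chop_op k) f = 0.
Proof.
move=> ki; apply/eqP; rewrite subr_eq0; apply/eqP/ell2P => w.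
by rewrite !comp_pull wm_del_append.
Qed.

Definition far_commutant : set (H -> H) :=
  asymptotic_commutant (fun n => append_op (- n%:Z))
                       (fun n => chop_op (- n%:Z)).

Lemma far_commutant_cstar : cstar_subalgebra far_commutant.
Proof.
apply: asymptotic_commutant_cstar => n.
- exact: (pull_bounded_operator _).1.
- exact: (pull_bounded_operator _).1.
- exact: pull_adjoint.
- exact: pullK.
- exact: pullK.
Qed.

(** The commutators even vanish as soon as -n < i. *)
Lemma far_commutant_creator i : far_commutant (creator i).
Proof.
have far : \forall n \near \oo, (- n%:Z < i :> int)%R.
  exists (absz i).+1 => // n /= ni; rewrite ltrNl.
  by rewrite (le_lt_trans (ler_norm _))// normrN -abszE ltz_nat.
split; first exact: creator_bounded.
- move=> e e0; near=> n => f; rewrite commutator_creator_append_op.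
    by rewrite normr0 mulr_ge0// lecR ltW.
  by near: n.
- move=> e e0; near=> n => f; rewrite commutator_creator_chop_op.
    by rewrite normr0 mulr_ge0// lecR ltW.
  by near: n.
Unshelve. all: by end_near. Qed.

Lemma wm_algebra_far_commutant : wm_algebra R `<=` far_commutant.
Proof.
apply: smallest_sub; first exact: far_commutant_cstar.
move=> T [i [bT iT]].
exact: (cstar_adjoint far_commutant_cstar (far_commutant_creator i)).
Qed.

Lemma append_op_vacuum k : append_op k vacuum = tensor [:: k].
Proof.
by rewrite /vacuum /tensor !insubT /append_op pull_basis /wm_append insubT.
Qed.

Lemma vacuum_projectionE P : orthogonal_projection (vacuum_line R) P ->
  forall f, P f = ip f vacuum *: vacuum.
Proof.
move=> Pproj f; have [[c _ cP] orth] := Pproj f.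
have vv : ip vacuum vacuum = 1 :> R[i].
  by rewrite /vacuum /tensor insubT basis_orthonormal eqxx.
have : ip (f - P f) vacuum = 0 by apply: orth; exists 1 => //; rewrite scale1r.
rewrite -cP ipBl -[c *: vacuum]addr0 ip_linearl vv mulr1.
rewrite [ip 0 _](_ : _ = 0) ?addr0; last by rewrite -(subrr vacuum) ipBl subrr.
by move/eqP; rewrite subr_eq0 => /eqP <-.
Qed.

(** The commutator with P moves Omega to - e_k, of the same norm as Omega, so
    it is never below 1/2 in norm. *)
Lemma vacuum_projection_not_far P :
  orthogonal_projection (vacuum_line R) P -> ~ far_commutant P.
Proof.
move=> /vacuum_projectionE PE [_ PV _].
have half : 0 < 2^-1 :> R by rewrite invr_gt0.
have [N _ /(_ N (leqnn N))/(_ vacuum)] := PV _ half.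
have vE : vacuum = basis (exist _ [::] isT) :> H.
  by rewrite /vacuum /tensor insubT.
have kE k : tensor [:: k] = basis (exist _ [:: k] isT) :> H.
  by rewrite /tensor insubT.
rewrite /commutator !PE append_op_vacuum.
have -> : ip (tensor [:: - N%:Z]) vacuum = 0 :> R[i].
  by rewrite vE kE basis_orthonormal.
have -> : ip vacuum vacuum = 1 :> R[i] by rewrite vE basis_orthonormal eqxx.
rewrite scale0r scale1r sub0r normrN append_op_vacuum !ell2_normE kE vE.
rewrite !basis_orthonormal !eqxx sqrtC1 mulr1 -[1]/(1%:C) lecR.
lra.
Qed.

End vacuum_projection.

Theorem proposition2p5 (R : realType) (P : wm_fock R -> wm_fock R) :
  orthogonal_projection (vacuum_line R) P -> ~ wm_algebra R P.
Proof.
move=> PP WP; apply: (vacuum_projection_not_far PP).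
exact: wm_algebra_far_commutant.
Qed.
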